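(* Let $\mathfrak{g}$ be the $8$-dimensional $2$-step nilpotent real Lie algebra with basis $X_1,\dots,X_6,Z_1,Z_2$ and Lie bracket $$[X_1,X_2]=Z_1,\quad [X_1,X_3]=Z_2,\quad [X_4,X_5]=Z_1,\quad [X_4,X_6]=Z_2$$ (all brackets of basis elements not determined by these via antisymmetry being zero). Then $\mathfrak{g}$ has exactly one rational form up to isomorphism.
   Context: A rational form of a real Lie algebra $\mathfrak{n}$ of dimension $n$ is an $n$-dimensional $\mathbb{Q}$-subspace $\mathfrak{n}^{\mathbb{Q}}\subset\mathfrak{n}$, closed under the Lie bracket, with $\mathfrak{n}^{\mathbb{Q}}\otimes\mathbb{R}=\mathfrak{n}$. Two rational forms $\mathfrak{n}^{\mathbb{Q}}_1,\mathfrak{n}^{\mathbb{Q}}_2$ of $\mathfrak{n}$ are isomorphic if $A\mathfrak{n}^{\mathbb{Q}}_1=\mathfrak{n}^{\mathbb{Q}}_2$ for some $A\in\mathrm{Aut}(\mathfrak{n})$, equivalently if they are isomorphic as Lie algebras over $\mathbb{Q}$. *)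

(* Defs.v *)
From HB Require Import structures.
From mathcomp Require Import all_boot all_order all_algebra.
From mathcomp Require Import classical_sets reals.
From mathcomp Require Import ring.

Set Implicit Arguments.
Unset Strict Implicit.
Unset Printing Implicit Defensive.

Import Order.TTheory GRing.Theory Num.Theory.

Local Open Scope classical_set_scope.
Local Open Scope ring_scope.

Record lieAlgebra (K : fieldType) (V : vectType K) := LieAlgebra {
  lie_bracket : V -> V -> V;
  lie_bracketPl : forall (a : K) (x y z : V),
    lie_bracket (a *: x + y) z = a *: lie_bracket x z + lie_bracket y z;
  lie_bracketPr : forall (a : K) (x y z : V),
    lie_bracket z (a *: x + y) = a *: lie_bracket z x + lie_bracket z y;
  lie_bracketxx : forall x : V, lie_bracket x x = 0;
  lie_jacobi : forall x y z : V,
    lie_bracket x (lie_bracket y z) + lie_bracket y (lie_bracket z x)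
      + lie_bracket z (lie_bracket x y) = 0
}.

Section RationalForms.

Variables (R : realType) (V : vectType R) (n : lieAlgebra V).

Definition rat_subspace (S : set V) : Prop :=
  [/\ S 0,
      forall x y : V, S x -> S y -> S (x + y)
    & forall (q : rat) (x : V), S x -> S (ratr q *: x)].

Definition rat_comb (d : nat) (b : 'I_d -> V) (c : 'I_d -> rat) : V :=
  \sum_(i < d) ratr (c i) *: b i.

Definition rat_basis (S : set V) (d : nat) (b : 'I_d -> V) : Prop :=
  (forall v : V, S v <-> exists c : 'I_d -> rat, v = rat_comb b c) /\
  (forall c : 'I_d -> rat, rat_comb b c = 0 -> forall i : 'I_d, c i = 0).

Definition rat_dim (S : set V) (d : nat) : Prop :=
  exists b : 'I_d -> V, rat_basis S b.

Definition real_span_full (S : set V) : Prop :=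
  exists2 X : seq V, (forall x : V, x \in X -> S x) & (<<X>> = {:V})%VS.

(* S (x) R = n means that the canonical map S (x)_Q R -> n, s (x) a |-> a *: s, *)
(* is an isomorphism. Its image is the real span of S; as dim_Q S = dim_R n, it *)
(* is bijective as soon as it is onto, and it then maps every Q-basis of S to   *)
(* an R-basis of n (rational_form_basis).                                       *)
Definition rational_form (S : set V) : Prop :=
  [/\ rat_subspace S,
      rat_dim S (\dim {:V}),
      forall x y : V, S x -> S y -> S (lie_bracket n x y)
    & real_span_full S].

Definition lie_automorphism (A : 'End(V)) : Prop :=
  bijective A /\
  (forall x y : V, A (lie_bracket n x y) = lie_bracket n (A x) (A y)).

Definition rational_form_iso (S1 S2 : set V) : Prop :=
  exists2 A : 'End(V), lie_automorphism A & A @` S1 = S2.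

Lemma rational_form_basis (S : set V) (b : (\dim {:V}).-tuple V) :
  rational_form S -> rat_basis S (tnth b) -> basis_of {:V} b.
Proof.
move=> [_ _ _ [X XS spanX]] [Sb _].
rewrite basisEdim size_tuple leqnn andbT.
suff: (<<X>> <= <<b>>)%VS by rewrite spanX.
apply/span_subvP => x /XS /Sb [c ->].
by apply: memv_suml => i _; apply/memvZ/memv_span/mem_tnth.
Qed.

End RationalForms.

Section TheLieAlgebraG.

Variable R : realType.

(* X_1, ..., X_6, Z_1, Z_2 are the vectors 0, ..., 7 of the standard basis.    *)
Definition gX (i : nat) : 'rV[R]_8 := delta_mx 0 (inord i.-1).
Definition gZ (k : nat) : 'rV[R]_8 := delta_mx 0 (inord (5 + k)).

Definition g_table (i j : nat) : 'rV[R]_8 :=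
  match i, j with
  | 1, 2 => gZ 1
  | 1, 3 => gZ 2
  | 4, 5 => gZ 1
  | 4, 6 => gZ 2
  | _, _ => 0%R
  end%N.

Definition g_bracket (x y : 'rV[R]_8) : 'rV[R]_8 :=
  \sum_(i < 8) \sum_(j < 8)
    (x 0 i * y 0 j) *: (g_table i.+1 j.+1 - g_table j.+1 i.+1).

Lemma g_bracketPl (a : R) (x y z : 'rV[R]_8) :
  g_bracket (a *: x + y) z = a *: g_bracket x z + g_bracket y z.
Proof.
rewrite /g_bracket scaler_sumr -big_split; apply: eq_bigr => i _ /=.
rewrite scaler_sumr -big_split; apply: eq_bigr => j _ /=.
by rewrite !mxE scalerA mulrDl mulrA scalerDl.
Qed.

Lemma g_bracketC (x y : 'rV[R]_8) : g_bracket x y = - g_bracket y x.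
Proof.
rewrite /g_bracket exchange_big -sumrN; apply: eq_bigr => i _ /=.
rewrite -sumrN; apply: eq_bigr => j _ /=.
by rewrite -scalerN opprB mulrC.
Qed.

Lemma g_bracketPr (a : R) (x y z : 'rV[R]_8) :
  g_bracket z (a *: x + y) = a *: g_bracket z x + g_bracket z y.
Proof.
by rewrite g_bracketC g_bracketPl opprD -scalerN -!(g_bracketC z).
Qed.

Lemma g_bracketxx (x : 'rV[R]_8) : g_bracket x x = 0.
Proof.
have /eqP := g_bracketC x x; rewrite -subr_eq0 opprK -mulr2n -scaler_nat.
by rewrite scaler_eq0 pnatr_eq0 => /eqP.
Qed.

Local Notation "v _[ i ]" := (v 0 (inord i))
  (at level 2, format "v _[ i ]") : ring_scope.

Lemma g_bracketE (x y : 'rV[R]_8) :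
  g_bracket x y =
    (x _[0] * y _[1] - x _[1] * y _[0] + x _[3] * y _[4] - x _[4] * y _[3])
      *: gZ 1
  + (x _[0] * y _[2] - x _[2] * y _[0] + x _[3] * y _[5] - x _[5] * y _[3])
      *: gZ 2.
Proof.
have eE (v : 'rV[R]_8) (i : 'I_8) : v 0 i = v _[i] by rewrite inord_val.
rewrite /g_bracket; under eq_bigr => i _ do under eq_bigr => j _ do
  rewrite (eE x) (eE y).
rewrite !big_ord_recl !big_ord0 /= /bump /=.
apply/rowP => k; rewrite !mxE; ring.
Qed.

Lemma g_bracket_step2 (x y z : 'rV[R]_8) : g_bracket x (g_bracket y z) = 0.
Proof.
rewrite [g_bracket y z]g_bracketE; set a := _ + _ - _; set b := _ + _ - _.
rewrite g_bracketE /gZ !mxE !eqxx -!val_eqE /= !inordK //=.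
by rewrite !(mulr0, addr0, mul0r, subr0, scale0r).
Qed.

Lemma g_jacobi (x y z : 'rV[R]_8) :
  g_bracket x (g_bracket y z) + g_bracket y (g_bracket z x)
    + g_bracket z (g_bracket x y) = 0.
Proof. by rewrite !g_bracket_step2 !addr0. Qed.

Definition g : lieAlgebra 'rV[R]_8 :=
  LieAlgebra g_bracketPl g_bracketPr g_bracketxx g_jacobi.

Lemma g_bracket_delta (i j : 'I_8) :
  lie_bracket g (delta_mx 0 i) (delta_mx 0 j) =
    g_table i.+1 j.+1 - g_table j.+1 i.+1.
Proof.
rewrite /= /g_bracket (bigD1 i) //= (bigD1 j) //= !mxE !eqxx mulr1 scale1r.
rewrite !big1 ?addr0 // => k kN; last by rewrite mxE (negPf kN) mulr0 scale0r.
by rewrite big1 // => l _; rewrite mxE (negPf kN) mul0r scale0r.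
Qed.

Lemma g_bracket_basis :
  [/\ lie_bracket g (gX 1) (gX 2) = gZ 1,
      lie_bracket g (gX 1) (gX 3) = gZ 2,
      lie_bracket g (gX 4) (gX 5) = gZ 1
    & lie_bracket g (gX 4) (gX 6) = gZ 2].
Proof. by split; rewrite g_bracket_delta !inordK // subr0. Qed.

End TheLieAlgebraG.

(* Main.v *)
(* Let [w] be the 6-dimensional abelian ideal spanned by [X2, X3, X5, X6, Z1,   *)
(* Z2]. Given a rational form [S], pick [x1, x4] in [S] independent modulo [w]  *)
(* and a basis [z1, z2] of the centre consisting of brackets of elements of     *)
(* [S]. The conditions [[x1, x] = z1], [[x4, x] = 0] and [[x, v] in R z1] for   *)
(* all [v] form a linear system with rational coefficients in a Q-basis of [S]; *)
(* it is solvable in [g], hence in [S], and its solutions lie in [w]. Exchanging *)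
(* [x1, x4] and [z1, z2] gives [x2, x3, x5, x6] in [S] dual to [x1, x4]; adding *)
(* to [x1] a rational combination of [x5, x6] makes [[x1, x4]] vanish. The      *)
(* resulting basis of [S] has the structure constants of the standard one.      *)
Require Import Defs.
From HB Require Import structures.
From mathcomp Require Import all_boot all_order all_algebra.
From mathcomp Require Import classical_sets reals.
From mathcomp Require Import ring.

Set Implicit Arguments.
Unset Strict Implicit.
Unset Printing Implicit Defensive.

Import Order.TTheory GRing.Theory Num.Theory.

Local Open Scope classical_set_scope.
Local Open Scope ring_scope.

(** Write [w] for the abelian ideal spanned by X2, X3, X5, X6, Z1, Z2 and [z] for the centre. The
    bracket identifies w/z with Hom(g/w, z), both g/w and z being planes. Hence any basis x1, x4 of
    g modulo [w] and any basis z1, z2 of [z] determine, modulo [z], dual vectors x2, x3, x5, x6 in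
    [w], and a correction of x1 by elements of [w] makes it commute with x4. So g has many bases
    with the standard structure constants ([adapted_iso]), and it suffices to find one inside a
    given rational form S. The difficulty is that [w] is not visibly defined over the rationals. It
    is avoided by asking that [x, v] lie in R z1 for all v: this is linear in x, rational on S, and
    already forces x into [w] ([dual_vector]). Solvability over R then descends to S
    ([rational_system]), because rank does not change under field extension. The same fact shows
    that real-independent vectors of S, as many as the dimension, form a Q-basis of S
    ([eq_rational_span]), so the automorphism so obtained carries the standard form onto S. *)

Section RationalSpan.

(** * Rational spans of real bases and descent of linear systems *)

Variables (R : realType) (n : nat).
Implicit Types (B : 'M[R]_n) (S : set 'rV[R]_n).

Local Notation "c ^Q" := (map_mx (ratr : rat -> R) c) (at level 2).

Definition rational_span B : set 'rV[R]_n :=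
  [set v | exists c : 'rV[rat]_n, v = c^Q *m B].

Lemma rational_rows m B (X : 'M[R]_(m, n)) :
  (forall i, rational_span B (row i X)) ->
  exists N : 'M[rat]_(m, n), X = N^Q *m B.
Proof.
move=> /fin_all_exists [M HM]; exists (\matrix_i M i).
by apply/row_matrixP => i; rewrite HM row_mul -map_row rowK.
Qed.

(** A rational row in the real row space of a rational matrix is already in its rational row space
    ([map_submx]); freeness of [X] identifies the two coefficient rows. *)
Lemma rational_coeffs m B (X : 'M[R]_(m, n)) (a : 'rV[R]_m) :
    B \in unitmx -> row_free X ->
    (forall i, rational_span B (row i X)) -> rational_span B (a *m X) ->
  exists c : 'rV[rat]_m, a = c^Q.
Proof.
move=> uB fX /rational_rows [N XE] [d Hd].
have aN : a *m N^Q = d^Q.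
  by apply: (can_inj (mulmxK uB)); rewrite -mulmxA -XE.
have /submxP [c dE] : (d <= N)%MS.
  by rewrite -(map_submx (ratr : {rmorphism rat -> R})) -aN submxMl.
exists c; apply: (row_free_inj fX).
by rewrite XE !mulmxA aN dE map_mxM.
Qed.

Lemma eq_rational_span B (X : 'M[R]_n) :
    B \in unitmx -> X \in unitmx -> (forall i, rational_span B (row i X)) ->
  rational_span X = rational_span B.
Proof.
move=> uB uX XB; apply/seteqP; split=> v; last first.
  move=> Bv; have [||c cE] := rational_coeffs (a := v *m invmx X) uB _ XB.
  - by rewrite row_free_unit.
  - by rewrite mulmxKV.
  by exists c; rewrite -cE mulmxKV.
have [N ->] := rational_rows XB => -[c ->].
by exists (c *m N); rewrite map_mxM mulmxA.
Qed.

Lemma rational_span_subspace B : rat_subspace (rational_span B).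
Proof.
split; first by exists 0; rewrite map_mx0 mul0mx.
  by move=> _ _ [c ->] [d ->]; exists (c + d); rewrite map_mxD mulmxDl.
by move=> q _ [c ->]; exists (q *: c); rewrite map_mxZ scalemxAl.
Qed.

Lemma rational_coeffs2 B (u v : 'rV[R]_n) (a b : R) :
    B \in unitmx -> (forall s t : R, s *: u + t *: v = 0 -> s = 0 /\ t = 0) ->
    rational_span B u -> rational_span B v -> rational_span B (a *: u + b *: v) ->
  (exists p : rat, a = ratr p) /\ (exists q : rat, b = ratr q).
Proof.
move=> uB fuv Su Sv Sw.
pose r (s t : R) : 'rV[R]_(1 + 1) := row_mx s%:M t%:M.
have rE s t : r s t *m col_mx u v = s *: u + t *: v.
  by rewrite mul_row_col !mul_scalar_mx.
have /(_ (r a b)) [|||c cE] := rational_coeffs (X := col_mx u v) uB.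
- rewrite -kermx_eq0; apply/rowV0P => w /sub_kermxP.
  have -> : w = r (w 0 (lshift 1 0)) (w 0 (rshift 1 0)).
    apply/rowP => i; rewrite -(splitK i); case: (split i) => k /=.
      by rewrite row_mxEl !mxE (ord1 k) eqxx.
    by rewrite row_mxEr !mxE (ord1 k) eqxx.
  rewrite rE => /fuv [-> ->].
  by rewrite /r !raddf0 row_mx0.
- move=> i; rewrite -(splitK i); case: (split i) => k /=.
    by rewrite rowKu (ord1 k) row_id.
  by rewrite rowKd (ord1 k) row_id.
- by rewrite rE.
split.
  exists (c 0 (lshift 1 0)); have /rowP /(_ (lshift 1 0)) := cE.
  by rewrite row_mxEl !mxE eqxx.
exists (c 0 (rshift 1 0)); have /rowP /(_ (rshift 1 0)) := cE.
by rewrite row_mxEr !mxE eqxx.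
Qed.

Definition functional (f : 'rV[R]_n -> R) : Prop :=
  forall a x y, f (a *: x + y) = a * f x + f y.

Lemma functional0 f : functional f -> f 0 = 0.
Proof.
move=> fl; have := fl 1 0 0; rewrite scaler0 addr0 mul1r => /eqP.
by rewrite -subr_eq0 opprD addrA subrr sub0r oppr_eq0 => /eqP.
Qed.

Lemma functional_mulmx f B (x : 'rV[R]_n) :
  functional f -> f (x *m B) = \sum_i x 0 i * f (row i B).
Proof.
move=> fl; rewrite mulmx_sum_row.
have fsum (s : seq 'I_n) : f (\sum_(i <- s) x 0 i *: row i B)
    = \sum_(i <- s) x 0 i * f (row i B).
  elim: s => [|i s IH]; first by rewrite !big_nil functional0.
  by rewrite !big_cons fl IH.
exact: fsum.
Qed.

Lemma row_rational_span B i : rational_span B (row i B).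
Proof.
by exists (delta_mx 0 i); rewrite map_delta_mx -rowE.
Qed.

(** The rows of [B] form a real basis, so a functional vanishing on all of them is zero. Used to
    move a nonvanishing condition from g into S, one argument at a time. *)
Lemma functional_neq0 f B v : B \in unitmx -> functional f -> f v != 0 ->
  exists2 u, rational_span B u & f u != 0.
Proof.
move=> uB fl fv; have [/forallP f0|] := boolP [forall i, f (row i B) == 0].
  case/eqP: fv; rewrite -(mulmxKV uB v) functional_mulmx // big1 // => i _.
  by rewrite (eqP (f0 i)) mulr0.
by case/forallPn => i fi; exists (row i B); first exact: row_rational_span.
Qed.

(** In the basis [B] the system has a rational matrix and a rational right-hand side, so a real
    solution yields a rational one. *)
Lemma rational_system k (f : 'I_k -> 'rV[R]_n -> R) (y : 'I_k -> rat) B x :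
    B \in unitmx -> (forall j, functional (f j)) ->
    (forall j v, rational_span B v -> exists q : rat, f j v = ratr q) ->
    (forall j, f j x = ratr (y j)) ->
  exists2 v, rational_span B v & forall j, f j v = ratr (y j).
Proof.
move=> uB fl frat fx.
have /fin_all_exists [N HN] : forall i, exists Ni : 'I_k -> rat,
    forall j, f j (row i B) = ratr (Ni j).
  move=> i; have [Ni HNi] := fin_all_exists (fun j => frat j _ (row_rational_span B i)).
  by exists Ni.
pose M := \matrix_(i, j) N i j.
pose Y := \row_j y j.
have fE (u : 'rV[R]_n) j : f j (u *m B) = (u *m M^Q) 0 j.
  rewrite functional_mulmx // mxE; apply: eq_bigr => i _.
  by rewrite HN !mxE.
have YE : Y^Q = (x *m invmx B) *m M^Q.
  by apply/rowP => j; rewrite -fE mulmxKV // fx !mxE.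
have /submxP [c cE] : (Y <= M)%MS.
  by rewrite -(map_submx (ratr : {rmorphism rat -> R})) YE submxMl.
exists (c^Q *m B); first by exists c.
by move=> j; rewrite fE -map_mxM -cE !mxE.
Qed.

End RationalSpan.

(** * Rational forms as rational spans of invertible matrices *)

Lemma dim_rV (R : realType) n : \dim {:'rV[R]_n} = n.
Proof. by rewrite dimvf /dim /= mul1n. Qed.

Lemma rational_form_span (R : realType) n (L : lieAlgebra 'rV[R]_n) S :
  rational_form L S -> exists2 B : 'M[R]_n, B \in unitmx & S = rational_span B.
Proof.
move=> [_ dimS _ [X XS spanX]]; move: dimS; rewrite dim_rV => -[b [bS _]].
pose B := \matrix_i b i.
have SE v : S v <-> rational_span B v.
  rewrite bS; split=> -[c ->].
    exists (\row_i c i); rewrite mulmx_sum_row /rat_comb.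
    by apply: eq_bigr => i _; rewrite rowK !mxE.
  exists (c 0); rewrite mulmx_sum_row /rat_comb.
  by apply: eq_bigr => i _; rewrite rowK !mxE.
exists B; last by apply/seteqP; split=> v /SE.
rewrite -row_full_unit; apply/row_fullP.
have subB v : exists c : 'rV_n, c *m B = v.
  suff /submxP [c ->] : (v <= B)%MS by exists c.
  have /(@coord_span _ _ _ (in_tuple X)) -> : v \in <<X>>%VS.
    by rewrite spanX memvf.
  apply: summx_sub => i _; apply: scalemx_sub.
  have /XS/SE [c ->] : (in_tuple X)`_i \in X by apply: mem_nth.
  exact: submxMl.
have /fin_all_exists [C HC] i := subB (delta_mx 0 i).
exists (\matrix_i C i); apply/row_matrixP => i.
by rewrite row_mul rowK HC rowE mulmx1.
Qed.

(** * Brackets and coordinates in g *)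

Section RationalFormsOfG.

Variable R : realType.
Implicit Types x y z : 'rV[R]_8.

Local Notation "v _[ i ]" := (v 0 (inord i))
  (at level 2, format "v _[ i ]") : ring_scope.
Local Notation brk := (@g_bracket R).

(* Coordinates are numbered from 0: the vectors X1, ..., X6, Z1, Z2 of the     *)
(* basis correspond to 0, ..., 7.                                              *)
Definition br1 x y :=
  x _[0] * y _[1] - x _[1] * y _[0] + x _[3] * y _[4] - x _[4] * y _[3].
Definition br2 x y :=
  x _[0] * y _[2] - x _[2] * y _[0] + x _[3] * y _[5] - x _[5] * y _[3].

(* The multiples of the Zi, which form the centre of g *)
Definition central z := z = z _[6] *: gZ R 1 + z _[7] *: gZ R 2.

(** Determinants in the coordinates X1, X4 and Z1, Z2: nonvanishing means independence modulo the
    abelian ideal and, for central vectors, being a basis of the centre. *)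
Definition detX x y := x _[0] * y _[3] - x _[3] * y _[0].
Definition detZ x y := x _[6] * y _[7] - x _[7] * y _[6].

Lemma bracketE x y : brk x y = br1 x y *: gZ R 1 + br2 x y *: gZ R 2.
Proof. exact: g_bracketE. Qed.

Lemma coordZ (a b : R) : let z := a *: gZ R 1 + b *: gZ R 2 in
  [/\ z _[0] = 0, z _[3] = 0, z _[6] = a & z _[7] = b].
Proof.
by split; rewrite !mxE -!val_eqE /= !inordK //= ?mulr0 ?mulr1 ?addr0 ?add0r.
Qed.

Lemma central_bracket x y : central (brk x y).
Proof. by rewrite /central bracketE; have [_ _ -> ->] := coordZ (br1 x y) (br2 x y). Qed.

Lemma bracket0 x y : x _[0] = 0 -> x _[3] = 0 -> y _[0] = 0 -> y _[3] = 0 ->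
  brk x y = 0.
Proof.
move=> x0 x3 y0 y3; rewrite bracketE /br1 /br2 x0 x3 y0 y3.
by rewrite !(mul0r, mulr0, subrr, addr0, scale0r).
Qed.

Lemma central_coord z : central z -> z _[0] = 0 /\ z _[3] = 0.
Proof. by move=> ->; have [-> ->] := coordZ z _[6] z _[7]. Qed.

Lemma bracket_central x z : central z -> brk x z = 0.
Proof.
move=> ->; rewrite bracketE /br1 /br2 !mxE -!val_eqE /= !inordK //=.
by rewrite !(mulr0, addr0, subr0, scale0r).
Qed.

(* The coordinates of [x, y] in the basis (z1, z2) of the centre *)
Definition coef1 z1 z2 x y :=
  (br1 x y * z2 _[7] - br2 x y * z2 _[6]) / detZ z1 z2.
Definition coef2 z1 z2 x y :=
  (br2 x y * z1 _[6] - br1 x y * z1 _[7]) / detZ z1 z2.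

Lemma bracket_coef z1 z2 x y : central z1 -> central z2 -> detZ z1 z2 != 0 ->
  brk x y = coef1 z1 z2 x y *: z1 + coef2 z1 z2 x y *: z2.
Proof.
move=> cz1 cz2 D; rewrite bracketE [X in _ = _ *: X + _]cz1 [X in _ = _ + _ *: X]cz2.
rewrite !scalerDr !scalerA addrACA -!scalerDl /coef1 /coef2.
by rewrite /detZ in D *; congr (_ *: _ + _ *: _); field.
Qed.

Lemma coef1_functional z1 z2 x : functional (coef1 z1 z2 x).
Proof. by move=> a u v; rewrite /coef1 /br1 /br2 !mxE; ring. Qed.

Lemma coef2_functional z1 z2 x : functional (coef2 z1 z2 x).
Proof. by move=> a u v; rewrite /coef2 /br1 /br2 !mxE; ring. Qed.

Lemma coef2C z1 z2 x y : coef2 z1 z2 x y = - coef2 z1 z2 y x.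
Proof. by rewrite /coef2 /br1 /br2; ring. Qed.

Lemma detZ_free z1 z2 (s t : R) : detZ z1 z2 != 0 ->
  s *: z1 + t *: z2 = 0 -> s = 0 /\ t = 0.
Proof.
move=> D /rowP e; have := e (inord 6); have := e (inord 7).
rewrite !mxE => e7 e6; split; apply: (mulIf D); rewrite mul0r /detZ.
  transitivity ((s * z1 _[6] + t * z2 _[6]) * z2 _[7]
              - (s * z1 _[7] + t * z2 _[7]) * z2 _[6]); first by ring.
  by rewrite e6 e7 !mul0r subrr.
transitivity ((s * z1 _[7] + t * z2 _[7]) * z1 _[6]
              - (s * z1 _[6] + t * z2 _[6]) * z1 _[7]); first by ring.
by rewrite e6 e7 !mul0r subrr.
Qed.

(** * An adapted basis inside a given rational form *)

Section Form.

Variables (B : 'M[R]_8) (uB : B \in unitmx).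
Local Notation S := (rational_span B).
Hypothesis S_brk : forall x y, S x -> S y -> S (brk x y).

Lemma coef_rational z1 z2 x y : central z1 -> central z2 -> detZ z1 z2 != 0 ->
    S z1 -> S z2 -> S x -> S y ->
  (exists p : rat, coef1 z1 z2 x y = ratr p) /\
  (exists q : rat, coef2 z1 z2 x y = ratr q).
Proof.
move=> cz1 cz2 D Sz1 Sz2 Sx Sy.
apply: (rational_coeffs2 uB _ Sz1 Sz2); first by move=> s t; apply: detZ_free.
by rewrite -bracket_coef //; apply: S_brk.
Qed.

Lemma dual_vector x1 x4 z1 z2 :
    central z1 -> central z2 -> detZ z1 z2 != 0 -> detX x1 x4 != 0 ->
    S x1 -> S x4 -> S z1 -> S z2 ->
  exists2 x, S x & [/\ x _[0] = 0, x _[3] = 0, brk x1 x = z1 & brk x4 x = 0].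
Proof.
move=> cz1 cz2 D E Sx1 Sx4 Sz1 Sz2.
(* Eight equations say that [row i B, x] has no z2-component; the last two prescribe the
   z1-components of [x1, x] and [x4, x] as 1 and 0. *)
pose f (j : 'I_(8 + 2)) x : R := match split j with
  | inl i => coef2 z1 z2 (row i B) x
  | inr i => coef1 z1 z2 (if i == 0 then x1 else x4) x end.
pose r (j : 'I_(8 + 2)) : rat := match split j with
  | inl i => 0 | inr i => (i == 0)%:R end.
(* By Cramer's rule, this is the vector of span(X2, X3, X5, X6) with the *)
(* prescribed brackets. *)
pose x : 'rV[R]_8 := \row_i [:: 0; x4 _[3] * z1 _[6] / detX x1 x4;
  x4 _[3] * z1 _[7] / detX x1 x4; 0; - x4 _[0] * z1 _[6] / detX x1 x4;
  - x4 _[0] * z1 _[7] / detX x1 x4; 0; 0]`_i.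
have fl j : functional (f j).
  by rewrite /f; case: (split j) => i; [apply: coef2_functional | apply: coef1_functional].
have fr j v : S v -> exists q : rat, f j v = ratr q.
  move=> Sv; rewrite /f; case: (split j) => i.
    by apply: (coef_rational _ _ D _ _ _ Sv).2 => //; apply: row_rational_span.
  by apply: (coef_rational _ _ D _ _ _ Sv).1 => //; case: ifP.
have fx j : f j x = ratr (r j).
  rewrite /f /r; case: (split j) => i.
    by rewrite rmorph0 /coef2 /br1 /br2 !mxE !inordK //=; ring.
  rewrite ratr_nat /coef1 /br1 /br2.
  by case: (i == 0); rewrite !mxE !inordK //= /detX /detZ in D E *; field; apply/andP.
have [v Sv Hv] := rational_system uB fl fr fx.
(* The eight equations on the rows of [B] extend by linearity to every y. *)
have v2 y : coef2 z1 z2 v y = 0.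
  rewrite -(mulmxKV uB y) functional_mulmx; last exact: coef2_functional.
  apply: big1 => i _; rewrite coef2C; have := Hv (lshift 2 i).
  by rewrite /f /r (unsplitK (inl i)) => ->; rewrite rmorph0 oppr0 mulr0.
have v1 (i : 'I_2) : coef1 z1 z2 (if i == 0 then x1 else x4) v = (i == 0)%:R.
  by have := Hv (rshift 8 i); rewrite /f /r (unsplitK (inr i)) ratr_nat.
have brv x' : brk x' v = coef1 z1 z2 x' v *: z1.
  by rewrite (bracket_coef _ _ cz1 cz2) // coef2C v2 oppr0 scale0r addr0.
have vcoord a : v _[a] * z1 _[6] = 0 -> v _[a] * z1 _[7] = 0 -> v _[a] = 0.
  move=> e6 e7; apply: (mulIf D); rewrite mul0r /detZ mulrBr !mulrA e6 e7.
  by rewrite !mul0r subrr.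
have w y : br2 v y * z1 _[6] = br1 v y * z1 _[7].
  by have /eqP := v2 y; rewrite mulf_eq0 invr_eq0 (negPf D) orbF subr_eq0 => /eqP.
(* [v, X2] = v_0 Z1 and [v, X3] = v_0 Z2 both lie in the line R z1, so v_0 = 0; likewise X5 and X6
   give v_3 = 0. *)
exists v => //; split.
- apply: vcoord.
    have := w (delta_mx 0 (inord 2)); rewrite /br1 /br2 !mxE -!val_eqE /= !inordK //=.
    by rewrite !(mulr0, mulr1, addr0, add0r, subr0, mul0r, oppr0) => E0.
  have := w (delta_mx 0 (inord 1)); rewrite /br1 /br2 !mxE -!val_eqE /= !inordK //=.
  by rewrite !(mulr0, mulr1, addr0, add0r, subr0, mul0r, oppr0) => <-.
- apply: vcoord.
    have := w (delta_mx 0 (inord 5)); rewrite /br1 /br2 !mxE -!val_eqE /= !inordK //=.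
    by rewrite !(mulr0, mulr1, addr0, add0r, subr0, mul0r, oppr0) => E0.
  have := w (delta_mx 0 (inord 4)); rewrite /br1 /br2 !mxE -!val_eqE /= !inordK //=.
  by rewrite !(mulr0, mulr1, addr0, add0r, subr0, mul0r, oppr0) => <-.
- by rewrite brv (v1 0) scale1r.
- by rewrite brv (v1 1) scale0r.
Qed.

(** [detX] is bilinear and nonzero at (X1, X4); its arguments are replaced in turn by elements of
    S. *)
Lemma exists_transversal : exists x1 x4, [/\ S x1, S x4 & detX x1 x4 != 0].
Proof.
have D0 : detX (delta_mx 0 (inord 0)) (delta_mx 0 (inord 3)) != 0.
  by rewrite /detX !mxE -!val_eqE /= !inordK //= mul1r mul0r subr0 oner_eq0.
have [|x1 Sx1 D1] := functional_neq0 (f := fun x => detX x _) uB _ D0.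
  by move=> a u v; rewrite /detX !mxE; ring.
have [|x4 Sx4 D4] := functional_neq0 (f := detX x1) uB _ D1.
  by move=> a u v; rewrite /detX !mxE; ring.
by exists x1, x4.
Qed.

Lemma exists_central_basis :
  exists z1 z2, [/\ S z1, S z2, central z1, central z2 & detZ z1 z2 != 0].
Proof.
pose e k : 'rV[R]_8 := delta_mx 0 (inord k).
have DE a b c d :
    detZ (brk a b) (brk c d) = br1 a b * br2 c d - br2 a b * br1 c d.
  rewrite /detZ !bracketE; have [_ _ -> ->] := coordZ (br1 a b) (br2 a b).
  by have [_ _ -> ->] := coordZ (br1 c d) (br2 c d).
have D0 : detZ (brk (e 0) (e 1)) (brk (e 0) (e 2)) != 0.
  rewrite DE /br1 /br2 /e !mxE -!val_eqE /= !inordK //=.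
  by rewrite !(mulr0, mulr1, addr0, add0r, subr0, mul0r) oner_eq0.
have [|a Sa Da] := functional_neq0 (f := fun x => detZ (brk x _) _) uB _ D0.
  by move=> t u v; rewrite !DE /br1 /br2 !mxE; ring.
have [|b Sb Db] := functional_neq0 (f := fun x => detZ (brk a x) _) uB _ Da.
  by move=> t u v; rewrite !DE /br1 /br2 !mxE; ring.
have [|c Sc Dc] := functional_neq0 (f := fun x => detZ _ (brk x _)) uB _ Db.
  by move=> t u v; rewrite !DE /br1 /br2 !mxE; ring.
have [|d Sd Dd] := functional_neq0 (f := fun x => detZ _ (brk c x)) uB _ Dc.
  by move=> t u v; rewrite !DE /br1 /br2 !mxE; ring.
exists (brk a b), (brk c d).
by split=> //; [apply: S_brk | apply: S_brk | apply: central_bracket | apply: central_bracket].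
Qed.

(* The span of X2, X3, X5, X6, Z1, Z2 *)
Definition in_abelian_ideal x := x _[0] = 0 /\ x _[3] = 0.

Record adapted x1 x2 x3 x4 x5 x6 z1 z2 : Prop := Adapted {
  adapted_mod : [/\ in_abelian_ideal x2, in_abelian_ideal x3, in_abelian_ideal x5 & in_abelian_ideal x6];
  adapted_center : central z1 /\ central z2;
  adapted_detX : detX x1 x4 != 0;
  adapted_detZ : detZ z1 z2 != 0;
  adapted_14 : brk x1 x4 = 0;
  adapted_1 : [/\ brk x1 x2 = z1, brk x1 x3 = z2, brk x1 x5 = 0 & brk x1 x6 = 0];
  adapted_4 : [/\ brk x4 x2 = 0, brk x4 x3 = 0, brk x4 x5 = z1 & brk x4 x6 = z2]
}.

Lemma exists_adapted : exists x1 x2 x3 x4 x5 x6 z1 z2,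
  adapted x1 x2 x3 x4 x5 x6 z1 z2 /\
  [/\ S x1, S x2, S x3 & S x4] /\ [/\ S x5, S x6, S z1 & S z2].
Proof.
have [x1 [x4 [Sx1 Sx4 E]]] := exists_transversal.
have [z1 [z2 [Sz1 Sz2 cz1 cz2 D]]] := exists_central_basis.
have E' : detX x4 x1 != 0 by rewrite -oppr_eq0 /detX opprB mulrC [x4 _[0] * _]mulrC.
have D' : detZ z2 z1 != 0 by rewrite -oppr_eq0 /detZ opprB mulrC [z2 _[6] * _]mulrC.
have [x2 Sx2 [x20 x23 b12 b42]] := dual_vector cz1 cz2 D E Sx1 Sx4 Sz1 Sz2.
have [x3 Sx3 [x30 x33 b13 b43]] := dual_vector cz2 cz1 D' E Sx1 Sx4 Sz2 Sz1.
have [x5 Sx5 [x50 x53 b45 b15]] := dual_vector cz1 cz2 D E' Sx4 Sx1 Sz1 Sz2.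
have [x6 Sx6 [x60 x63 b46 b16]] := dual_vector cz2 cz1 D' E' Sx4 Sx1 Sz2 Sz1.
have [[p pE] [q qE]] := coef_rational cz1 cz2 D Sz1 Sz2 Sx1 Sx4.
have [_ SD SZ] := rational_span_subspace B.
(* Since [x1, x4] = p z1 + q z2, [x5, x4] = -z1 and [x6, x4] = -z2, this correction kills [x1, x4];
   brackets with the abelian ideal are unchanged. *)
pose x1' := ratr p *: x5 + (ratr q *: x6 + x1).
have bw x : in_abelian_ideal x -> brk x1' x = brk x1 x.
  by case=> x0 x3'; rewrite /x1' !g_bracketPl (bracket0 x50) // (bracket0 x60) // !scaler0 !add0r.
exists x1', x2, x3, x4, x5, x6, z1, z2; split; last first.
  by split; split=> //; apply: (SD); [apply: SZ | apply: (SD) => //; apply: SZ].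
split=> //.
- by rewrite /detX /x1' !mxE x50 x53 x60 x63 !mulr0 !add0r.
- rewrite /x1' !g_bracketPl [brk x5 _]g_bracketC b45 [brk x6 _]g_bracketC b46.
  by rewrite (bracket_coef x1 x4 cz1 cz2 D) pE qE !scalerN addrA -opprD addNr.
- by rewrite !bw.
Qed.

Lemma adapted_iso x1 x2 x3 x4 x5 x6 z1 z2 (X : 'M[R]_8) :
    adapted x1 x2 x3 x4 x5 x6 z1 z2 ->
    (forall i, row i X = [:: x1; x2; x3; x4; x5; x6; z1; z2]`_i) ->
  X \in unitmx /\ forall x y, brk x y *m X = brk (x *m X) (y *m X).
Proof.
case=> [[n2 n3 n5 n6] [cz1 cz2] E D b14 [b12 b13 b15 b16] [b42 b43 b45 b46]] rX.
(* The component of [x *m X] in the abelian ideal. *)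
pose w x : 'rV[R]_8 := x _[1] *: x2 + (x _[2] *: x3 + (x _[4] *: x5 + (x _[5] *: x6
  + (x _[6] *: z1 + (x _[7] *: z2 + 0))))).
have XE x : x *m X = x _[0] *: x1 + (x _[3] *: x4 + w x).
  rewrite mulmx_sum_row; have xE (i : 'I_8) : x 0 i = x _[i] by rewrite inord_val.
  under eq_bigr => i _ do rewrite rX xE.
  rewrite !big_ord_recl big_ord0 /= /bump /= /w.
  by congr (_ + _); apply/rowP => k; rewrite !mxE; ring.
have wn x : in_abelian_ideal (w x).
  case: n2 n3 n5 n6 => [a2 c2] [a3 c3] [a5 c5] [a6 c6].
  have [a7 c7] := central_coord cz1; have [a8 c8] := central_coord cz2.
  by split; rewrite !mxE !(a2, a3, a5, a6, a7, a8, c2, c3, c5, c6, c7, c8) !mulr0 !addr0.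
have brk0 x : brk x 0 = 0 by have := g_bracketPr (-1) 0 0 x; rewrite scaler0 addr0 scaleN1r addNr.
have b1w x : brk x1 (w x) = x _[1] *: z1 + x _[2] *: z2.
  rewrite /w !g_bracketPr b12 b13 b15 b16 (bracket_central _ cz1) (bracket_central _ cz2) brk0.
  by rewrite !scaler0 !addr0.
have b4w x : brk x4 (w x) = x _[4] *: z1 + x _[5] *: z2.
  rewrite /w !g_bracketPr b42 b43 b45 b46 (bracket_central _ cz1) (bracket_central _ cz2) brk0.
  by rewrite !scaler0 !addr0 !add0r.
have wb1 x : brk (w x) x1 = - (x _[1] *: z1 + x _[2] *: z2).
  by rewrite g_bracketC b1w.
have wb4 x : brk (w x) x4 = - (x _[4] *: z1 + x _[5] *: z2).
  by rewrite g_bracketC b4w.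
have ww x y : brk (w x) (w y) = 0.
  by have [? ?] := wn x; have [? ?] := wn y; apply: bracket0.
have b41 : brk x4 x1 = 0 by rewrite g_bracketC b14 oppr0.
split.
  (* In a linear relation, [detX] kills the coefficients of x1 and x4, bracketing with x1 and x4
     those of x2, x3, x5, x6, and [detZ] those of z1 and z2. *)
  rewrite -row_free_unit -kermx_eq0; apply/rowV0P => u /sub_kermxP.
  rewrite XE => mu0.
  have [e0 e3] : u _[0] * x1 _[0] + u _[3] * x4 _[0] = 0 /\
                 u _[0] * x1 _[3] + u _[3] * x4 _[3] = 0.
    move: (w u) (wn u) mu0 => v [v0 v3] /rowP e.
    split; [have := e (inord 0) | have := e (inord 3)].
      by rewrite !mxE v0 addr0.
    by rewrite !mxE v3 addr0.
  have u0 : u _[0] = 0.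
    apply: (mulIf E); rewrite mul0r.
    transitivity ((u _[0] * x1 _[0] + u _[3] * x4 _[0]) * x4 _[3]
      - (u _[0] * x1 _[3] + u _[3] * x4 _[3]) * x4 _[0]).
      by rewrite /detX; ring.
    by rewrite e0 e3 !mul0r subrr.
  have u3 : u _[3] = 0.
    apply: (mulIf E); rewrite mul0r.
    transitivity ((u _[0] * x1 _[3] + u _[3] * x4 _[3]) * x1 _[0]
      - (u _[0] * x1 _[0] + u _[3] * x4 _[0]) * x1 _[3]).
      by rewrite /detX; ring.
    by rewrite e0 e3 !mul0r subrr.
  have wu : w u = 0 by move: mu0; rewrite u0 u3 !scale0r !add0r.
  have [u1 u2] : u _[1] = 0 /\ u _[2] = 0.
    by apply: (detZ_free D); rewrite -b1w wu brk0.
  have [u4 u5] : u _[4] = 0 /\ u _[5] = 0.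
    by apply: (detZ_free D); rewrite -b4w wu brk0.
  have [u6 u7] : u _[6] = 0 /\ u _[7] = 0.
    apply: (detZ_free D); move: wu.
    by rewrite /w u1 u2 u4 u5 !scale0r !add0r addr0.
  apply/rowP => i; rewrite -(inord_val i) [RHS]mxE.
  by case: i => [[|[|[|[|[|[|[|[|]]]]]]]]].
have gZE (a b : R) : (a *: gZ R 1 + b *: gZ R 2) *m X = a *: z1 + b *: z2.
  by rewrite mulmxDl -!scalemxAl -!rowE !rX !inordK.
(* With [w] opaque, bilinear expansion stops at the three-term decomposition [XE]. *)
clearbody w; move=> x y; rewrite bracketE gZE !XE !g_bracketPl !g_bracketPr.
rewrite !g_bracketxx b14 b41 b1w b4w wb1 wb4 ww /br1 /br2.
by apply/rowP => k; rewrite !mxE; ring.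
Qed.

End Form.

End RationalFormsOfG.

(** * The standard rational form and uniqueness *)

Lemma rational_form_std (R : realType) : rational_form (g R) (rational_span 1%:M).
Proof.
have SE v : rational_span (1%:M : 'M[R]_8) v <->
    exists c : 'rV[rat]_8, v = map_mx ratr c.
  by split=> -[c ->]; exists c; rewrite mulmx1.
split; first exact: rational_span_subspace.
- rewrite dim_rV; exists (delta_mx 0).
  have combE (c : 'I_8 -> rat) :
      rat_comb (delta_mx 0) c = map_mx ratr (\row_i c i) :> 'rV[R]_8.
    rewrite /rat_comb [RHS]row_sum_delta; apply: eq_bigr => i _.
    by rewrite !mxE.
  split=> [v|c]; last first.
    rewrite combE => /rowP c0 i; have := c0 i.
    by rewrite !mxE => /eqP; rewrite fmorph_eq0 => /eqP.
  rewrite SE; split=> -[c ->]; last by exists (\row_i c i).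
  by exists (c 0); rewrite combE; congr map_mx; apply/rowP => i; rewrite mxE.
- move=> x y /SE [c ->] /SE [d ->]; apply/SE.
  exists (\row_k [:: 0; 0; 0; 0; 0; 0;
    c 0 (inord 0) * d 0 (inord 1) - c 0 (inord 1) * d 0 (inord 0)
    + c 0 (inord 3) * d 0 (inord 4) - c 0 (inord 4) * d 0 (inord 3);
    c 0 (inord 0) * d 0 (inord 2) - c 0 (inord 2) * d 0 (inord 0)
    + c 0 (inord 3) * d 0 (inord 5) - c 0 (inord 5) * d 0 (inord 3)]`_k).
  rewrite /= bracketE /br1 /br2; apply/rowP => k; rewrite !mxE.
  rewrite -!val_eqE /= !inordK //.
  case: k => [[|[|[|[|[|[|[|[|]]]]]]]]] //= _;
  by rewrite ?(rmorph0, rmorphB, rmorphD, rmorphM) /=; ring.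
exists [seq delta_mx 0 i | i : 'I_8].
  move=> _ /mapP [i _ ->]; apply/SE; exists (delta_mx 0 i).
  by rewrite map_delta_mx.
apply/eqP; rewrite eqEsubv subvf /=; apply/subvP => v _.
rewrite (row_sum_delta v); apply: memv_suml => i _; apply/memvZ/memv_span.
by apply: map_f; rewrite mem_enum.
Qed.

Theorem proposition2p8 (R : realType) :
  exists S : set 'rV[R]_8,
    rational_form (g R) S /\
    (forall S' : set 'rV[R]_8,
       rational_form (g R) S' -> rational_form_iso (g R) S S').
Proof.
exists (rational_span 1%:M); split; first exact: rational_form_std.
move=> S' formS'; have [B uB S'E] := rational_form_span formS'.
have [_ _ S'brk _] := formS'; rewrite {}S'E {formS'} in S'brk *.
have [x1 [x2 [x3 [x4 [x5 [x6 [z1 [z2 [ad [[? ? ? ?] [? ? ? ?]]]]]]]]]]] :=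
  exists_adapted uB S'brk.
pose X : 'M[R]_8 := \matrix_i [:: x1; x2; x3; x4; x5; x6; z1; z2]`_i.
have rX (i : 'I_8) : row i X = [:: x1; x2; x3; x4; x5; x6; z1; z2]`_i.
  exact: rowK.
have [uX Xbrk] := adapted_iso ad rX.
have AE v : linfun (mulmxr X) v = v *m X by rewrite lfunE.
exists (linfun (mulmxr X)).
  split; last by move=> x y; rewrite !AE; apply: Xbrk.
  by exists (mulmx^~ (invmx X)) => v; rewrite AE ?mulmxK ?mulmxKV.
rewrite -(@eq_rational_span _ _ B X) //; last first.
  move=> i; rewrite rX.
  by case: i => [[|[|[|[|[|[|[|[|]]]]]]]]].
apply/seteqP; split=> [_ [_ [c ->] <-]|_ [c ->]].
  by exists c; rewrite AE mulmx1.
exists (map_mx ratr c); last by rewrite AE.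
by exists c; rewrite mulmx1.
Qed.
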